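(* For every number of candidates $m\ge 2$ and every $\beta\ge 1$, the utilitarian distortion of the Plurality rule under the Plackett–Luce model with parameter $\beta$ satisfies $$\mathcal{D}_{m,\beta}(\mathrm{Plurality})\;\le\;\min\left(\frac{m e^{\beta}}{\ln(m-1)+2}+1,\ \frac{e^{2\beta}}{\beta}\right).$$
   Context: Setting. $C$ is a set of $m$ candidates and $\beta\ge 1$ is a real parameter. Let $\mathcal{V}$ be a probability distribution on $[0,1]^C$ (utility vectors). For each $n$, the utility vectors $\mathbf{u}_1,\dots,\mathbf{u}_n$ of $n$ voters are drawn i.i.d. from $\mathcal{V}$, with $u_{i,j}\in[0,1]$ the utility of voter $i$ for candidate $j$. Given the utilities, each voter $i$ independently submits a random ranking $\pi_i$ of $C$ drawn from the Plackett–Luce model: positions are filled from top to bottom, and at each step a candidate $j$ is chosen among the not yet ranked candidates with probability proportional to $e^{\beta u_{i,j}}$. A voting rule $f$ maps each profile $\pi^n=(\pi_1,\dots,\pi_n)$ (for every $n$) to a probability distribution over $C$; it is deterministic if it always selects a single winner. Put $\mathrm{Util}_j=\mathbb{E}_{\mathbf{u}\sim\mathcal{V}}[u_j]$ and $\mathrm{Util}_n(f)=\mathbb{E}\big[\tfrac1n\sum_{i=1}^n u_{i,f(\pi^n)}\big]$, the expectation being over utilities, rankings and any internal randomness of $f$. The utilitarian distortion is $$\mathcal{D}_{m,\beta}(f)=\sup_{\mathcal{V}}\ \limsup_{n\to\infty}\ \frac{\max_{j\in C}\mathrm{Util}_j}{\mathrm{Util}_n(f)},$$ with the ratio taken to be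 $1$ if numerator and denominator are both $0$. Plurality rule. Selects the candidate ranked first by the largest number of voters (ties broken by an arbitrary fixed rule). *)

(* Defs.v *)
From HB Require Import structures.
From mathcomp Require Import all_boot all_order all_algebra all_fingroup.
From mathcomp Require Import all_classical all_reals all_analysis.

Set Implicit Arguments.
Unset Strict Implicit.
Unset Printing Implicit Defensive.

Import Order.TTheory GRing.Theory Num.Theory.

Local Open Scope classical_set_scope.
Local Open Scope ring_scope.

Section iid_law.
Context d (T : measurableType d) (R : realType).

Definition tcons n (x : T * n.-tuple T) : n.+1.-tuple T := [tuple of x.1 :: x.2].

Lemma measurable_tcons n : measurable_fun [set: T * n.-tuple T] (@tcons n).
Proof. exact: measurable_cons measurable_fst measurable_snd. Qed.

HB.instance Definition _ n :=
  isMeasurableFun.Build _ _ _ _ (@tcons n) (@measurable_tcons n).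

(* The law of n independent draws from P, i.e. the product measure P^n. *)
Fixpoint iid_law (P : probability T R) n : probability (n.-tuple T) R :=
  if n is k.+1 then distribution (P \x iid_law P k)%E (@tcons k)
  else \d_ [tuple].

Lemma iid_law_rect (P : probability T R) n (A : 'I_n -> set T) :
  (forall i, measurable (A i)) ->
  iid_law P n [set x | forall i, A i (tnth x i)] = (\prod_(i < n) P (A i))%E.
Proof.
elim: n A => [|n IHn] A mA.
  rewrite big_ord0 /= diracE mem_set//=; by case.
rewrite big_ord_recl -(IHn (fun i => A (lift ord0 i)))//.
rewrite -product_measure1E//=; last first.
  rewrite (_ : mkset _ = \bigcap_(i in [set: 'I_n])
     ((fun x : n.-tuple T => tnth x i) @^-1` A (lift ord0 i))); last first.
    by apply/seteqP; split=> x /= Ax i; [move=> _|]; exact: Ax.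
  apply: fin_bigcap_measurable => [|i _]; first exact: finite_finset.
  by rewrite -[_ @^-1` _]setTI; exact: measurable_tnth.
rewrite /distribution /pushforward; congr (_ _).
apply/seteqP; split=> -[x s] /= Ax.
  split; first exact: (Ax ord0).
  by move=> i; have := Ax (lift ord0 i); rewrite tnthS.
by move=> i; case: (unliftP ord0 i) => [j|] ->; [rewrite tnthS; exact: Ax.2|
  exact: Ax.1].
Qed.

End iid_law.

Section distortion.
Variables (R : realType) (m : nat).

Definition utilities := m.-tuple (measurableTypeR R).

(* A ranking s lists the candidates from top to bottom: s k is the candidate
   in position k, position 0 being the top one. *)
Definition ranking := 'S_m.

Definition unit_cube : set utilities :=
  [set u | forall j : 'I_m, 0 <= tnth u j <= 1].

(* At position k the candidates not yet ranked are the s l with k <= l. *)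
Definition plackett_luce (beta : R) (u : utilities) (s : ranking) : R :=
  \prod_(k < m) (expR (beta * tnth u (s k)) /
                 \sum_(l < m | (k <= l)%N) expR (beta * tnth u (s l))).

(* vr_prob f p c is the probability that c wins at profile p. *)
Record voting_rule := VotingRule {
  vr_prob :> forall n, n.-tuple ranking -> 'I_m -> R;
  _ : forall n (p : n.-tuple ranking) c, 0 <= vr_prob p c;
  _ : forall n (p : n.-tuple ranking), \sum_c vr_prob p c = 1 }.

Section deterministic.
Variable w : forall n, n.-tuple ranking -> 'I_m.

Let indicator n (p : n.-tuple ranking) (c : 'I_m) : R := (c == w p)%:R.

Let indicator_ge0 n (p : n.-tuple ranking) c : 0 <= indicator p c.
Proof. exact: ler0n. Qed.

Let indicator_sum n (p : n.-tuple ranking) : \sum_c indicator p c = 1.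
Proof. by rewrite /indicator (bigD1 (w p))//= eqxx big1 ?addr0// => c /negPf ->. Qed.

Definition deterministic_rule := VotingRule indicator_ge0 indicator_sum.

End deterministic.

Definition ranked_first (c : 'I_m) (s : ranking) : bool :=
  [exists k : 'I_m, (k == 0%N :> nat) && (s k == c)].

Definition plurality_score n (p : n.-tuple ranking) (c : 'I_m) : nat :=
  count (ranked_first c) p.

(* Leaving w unspecified among the tied candidates amounts to quantifying over
   all deterministic tie-breaking rules. *)
Definition plurality_winner (w : forall n, n.-tuple ranking -> 'I_m) : Prop :=
  forall n (p : n.-tuple ranking) c,
    (plurality_score p c <= plurality_score p (w n p))%N.

Section utility.
Local Open Scope ereal_scope.

Definition util (V : probability utilities R) (j : 'I_m) : \bar R :=
  \int[V]_u (tnth u j)%:E.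

Definition max_util (V : probability utilities R) : \bar R :=
  \big[maxe/-oo]_(j < m) util V j.

(* Conditional expectation, given the utilities us, of the average utility of
   the winner: the rankings are independent given us. *)
Definition mean_winner_utility (beta : R) (f : voting_rule) n
    (us : n.-tuple utilities) : R :=
  (\sum_(p : n.-tuple ranking)
     (\prod_(i < n) plackett_luce beta (tnth us i) (tnth p i)) *
     \sum_(c < m) f n p c * (n%:R^-1 * \sum_(i < n) tnth (tnth us i) c))%R.

Definition util_rule (beta : R) (V : probability utilities R) (f : voting_rule)
    (n : nat) : \bar R :=
  \int[iid_law V n]_us (mean_winner_utility beta f us)%:E.

(* In the extended reals x / 0 = +oo for x > 0. *)
Definition util_ratio (x y : \bar R) : \bar R :=
  if (x == 0) && (y == 0) then 1 else x / y.

Definition distortion (beta : R) (f : voting_rule) : \bar R :=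
  ereal_sup [set limn_esup (fun n => util_ratio (max_util V) (util_rule beta V f n))
            | V in [set V : probability utilities R | V unit_cube = 1]].

End utility.
End distortion.

(* Main.v *)
Require Import Defs.
From mathcomp Require Import all_boot all_order all_algebra all_fingroup.
From mathcomp Require Import all_classical all_reals all_analysis.
From mathcomp Require Import measurable_realfun ring lra.

(* Let p_j(u) be the probability that a voter with utilities u ranks j first,
   b = m e^beta / beta, and B0 the minimum of m e^beta / (ln (m - 1) + 2) and
   e^beta (e^beta - 1) / beta, which is smaller than the claimed bound B.  As
   the denominator S of p_j lies between max (m, e^(beta u_j) + m - 1) and
   m e^beta, one has for all u in the cube
     u_k <= b (e^(beta u_k) - 1) / S
          = b (e^(beta u_j) - 1) / S + b (p_k(u) - p_j(u))
         <= B0 u_j + b (p_k(u) - p_j(u)).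
   Average this over the voters with j the plurality winner.  The winner has at
   least as many first places as k, and for independent rankings the numbers of
   first places differ from the sums of the p_c(u_i) by O(sqrt n) in mean, so
   Util_k <= B0 Util_n + O(1 / sqrt n).  Since B0 < B, the ratio is at most B
   for all large n. *)

Set Implicit Arguments.
Unset Strict Implicit.
Unset Printing Implicit Defensive.

Import Order.TTheory GRing.Theory Num.Theory.
Import numFieldNormedType.Exports.

Local Open Scope classical_set_scope.
Local Open Scope ring_scope.

(** * Two inequalities for the exponential function *)

Lemma expR_chord (R : realType) (a x : R) : 0 <= x <= 1 ->
  expR (a * x) - 1 <= (expR a - 1) * x.
Proof.
move=> x01; have := convex_expR (Itv01 (proj1 (andP x01)) (proj2 (andP x01)))
  a (0 : R).
by rewrite !convRE /= expR0 mulr0 addr0 mulr1 (mulrC x a) /unstable.onem; lra.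
Qed.

(** With L = ln M, the right side minus the left side vanishes at t = 0 and has derivative e^t (e^(L
    - t) - 1 - (L - t)), which is nonnegative since e^x >= 1 + x. Taken at M = m - 1, it is the
    source of the term ln (m - 1) + 2. *)
Lemma expR_logistic_bound (R : realType) (M t : R) : 0 < M -> 0 <= t ->
  (expR t - 1) * (ln M + 2) <= t * (expR t + M).
Proof.
move=> M0 t0; set L := ln M.
have ML : M = expR L by rewrite lnK.
pose f (s : R) : R := s * (expR s + M) - (expR s - 1) * (L + 2).
pose df (s : R) : R := expR s * (s - L - 1) + M.
have fd (s : R) : is_derive s 1 f (df s).
  rewrite /f /df; apply: is_derive_eq.
  rewrite /GRing.scale /=; ring.
have df0 s : 0 <= df s.
  have -> : df s = expR s * (expR (L - s) - (1 + (L - s))).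
    have EL : expR L = expR (L - s) * expR s by rewrite -expRD subrK.
    by rewrite /df ML EL; ring.
  by rewrite mulr_ge0 ?expR_ge0// subr_ge0 expR_ge1Dx.
have [->|tn0] := eqVneq t 0; first by rewrite expR0 subrr !mul0r.
have tgt0 : 0 < t by rewrite lt_def tn0.
have cf : {within `[0, t], continuous f}%classic.
  by apply: derivable_within_continuous => x _; have [] := fd x.
have [c _] := MVT tgt0 (fun x _ => fd x) cf.
rewrite {2}/f mul0r expR0 subrr mul0r subrr !subr0 => fE.
by rewrite -subr_ge0 -/(f t) fE mulr_ge0.
Qed.

(** * Second moments under a product distribution on tuples *)

Section product_moment.
Variables (R : realType) (T : finType) (n : nat).
Variables (q X : 'I_n -> T -> R).
Hypothesis q_ge0 : forall i t, 0 <= q i t.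
Hypothesis q_sum : forall i, \sum_t q i t = 1.

(** Finite functions are the index type for which [bigA_distr_bigA] expands a product of sums. *)
Lemma sum_tupleE (F : ('I_n -> T) -> R) :
  (forall f g, f =1 g -> F f = F g) ->
  \sum_(p : n.-tuple T) F (tnth p) = \sum_(f : {ffun 'I_n -> T}) F f.
Proof.
move=> FE.
rewrite (reindex (fun p : n.-tuple T => [ffun i => tnth p i])) /=; last first.
  exists (fun f : {ffun 'I_n -> T} => [tuple f i | i < n]) => [p _|f _].
    by apply: eq_from_tnth => i; rewrite tnth_mktuple ffunE.
  by apply/ffunP => i; rewrite ffunE tnth_mktuple.
by apply: eq_bigr => p _; apply: FE => i; rewrite ffunE.
Qed.

Lemma product_sum1 : \sum_(p : n.-tuple T) \prod_(i < n) q i (tnth p i) = 1.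
Proof.
rewrite (sum_tupleE (F := fun f => \prod_(i < n) q i (f i))) => [|f g fg].
  by rewrite -bigA_distr_bigA big1.
by apply: eq_bigr => i _; rewrite fg.
Qed.

(** The variance of a sum of independent centred variables is the sum of their variances, each at
    most 1 here. *)
Lemma product_second_moment :
  (forall i, \sum_t q i t * X i t = 0) -> (forall i t, `|X i t| <= 1) ->
  \sum_(p : n.-tuple T)
     (\prod_(i < n) q i (tnth p i)) * (\sum_(i < n) X i (tnth p i)) ^+ 2
  <= n%:R.
Proof.
move=> X0 X1.
rewrite (sum_tupleE
  (F := fun f => (\prod_(i < n) q i (f i)) * (\sum_(i < n) X i (f i)) ^+ 2));
  last first.
  move=> f g fg; congr (_ * _ ^+ 2); first by apply: eq_bigr => i _; rewrite fg.
  by apply: eq_bigr => i _; rewrite fg.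
(* Padding X_i X_k with factors 1 turns each term of the expanded square into a product over all
   coordinates, whose sum over f is then a product of one-coordinate sums. *)
have YE i k (f : {ffun 'I_n -> T}) :
    (\prod_l q l (f l)) * (X i (f i) * X k (f k)) =
    \prod_l (q l (f l) * ((if l == i then X l (f l) else 1) *
                          (if l == k then X l (f l) else 1))).
  by rewrite !big_split /= -!big_mkcond /= !big_pred1_eq.
under eq_bigr => f _.
  rewrite expr2 mulr_suml mulr_sumr.
  under eq_bigr => i _.
    rewrite mulr_sumr mulr_sumr; under eq_bigr do rewrite YE; over.
  over.
rewrite exchange_big /= -[in leRHS](card_ord n) -sum1_card natr_sum.
apply: ler_sum => i _; rewrite exchange_big /=.
(* By independence only the diagonal terms [k = i] survive. *)
under eq_bigr => k _ do rewrite -(bigA_distr_bigA (fun l t => q l t *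
  ((if l == i then X l t else 1) * (if l == k then X l t else 1)))).
rewrite (bigD1 i)//= [X in _ + X]big1 ?addr0 => [|k ki].
  rewrite (bigD1 i)//= eqxx [X in _ * X]big1 ?mulr1 => [|l /negPf ->].
    rewrite -(q_sum i); apply: ler_sum => t _.
    rewrite ler_piMr// (le_trans (ler_norm _))// normrM.
    by rewrite mulr_ile1.
  by under eq_bigr do rewrite !mulr1; rewrite q_sum.
rewrite (bigD1 i)//= eqxx eq_sym (negPf ki).
by under eq_bigr do rewrite mulr1; rewrite X0 mul0r.
Qed.

End product_moment.

(** * Luce rankings: splitting off the top candidate *)

Lemma sum_lift_perm (R : nmodType) n (F : 'S_n.+1 -> R) :
  \sum_s F s = \sum_c \sum_(s : 'S_n) F (lift_perm ord0 c s).
Proof.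
rewrite pair_bigA /= (reindex (fun x => lift_perm ord0 x.1 x.2))//=.
(* An injection between finite types is a bijection once the cardinalities agree: (n + 1) n! = (n +
   1)!. *)
apply/onW_bij/inj_card_bij => [[c s] [c' s'] /= E|].
  have cc' : c = c' by rewrite -(lift_perm_id ord0 c s) E lift_perm_id.
  rewrite -{}cc' in E *; congr (_, _); apply/permP => k.
  by apply: (@lift_inj _ c); rewrite -!(lift_perm_lift ord0) E.
by rewrite card_prod card_ord !card_Sn factS.
Qed.

Section luce.
Variable R : realType.

(** Arbitrary weights [a] replace the exponentials so that the model left after removing the top
    candidate, with weights [a \o lift c], has the same form and induction on [n] applies. *)
Definition luce n (a : 'I_n -> R) (s : 'S_n) : R :=
  \prod_(k < n) (a (s k) / \sum_(l < n | (k <= l)%N) a (s l)).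

Lemma luce_lift n (a : 'I_n.+1 -> R) c s :
  luce a (lift_perm ord0 c s) = a c / (\sum_l a l) * luce (a \o lift c) s.
Proof.
rewrite /luce big_ord_recl lift_perm_id; congr (_ / _ * _).
  rewrite [RHS](reindex_inj (@perm_inj _ (lift_perm ord0 c s))).
  exact: eq_bigl.
apply: eq_bigr => k _; rewrite lift_perm_lift /=; congr (_ / _).
rewrite big_mkcond big_ord_recl /= add0r -big_mkcond /=.
by apply: eq_bigr => l _; rewrite lift_perm_lift.
Qed.

Lemma luce_ge0 n (a : 'I_n -> R) s : (forall j, 0 < a j) -> 0 <= luce a s.
Proof.
move=> a0; apply: prodr_ge0 => k _.
by rewrite divr_ge0 ?sumr_ge0 ?ltW// => l _; exact: ltW.
Qed.

Lemma luce_sum n (a : 'I_n -> R) : (forall j, 0 < a j) -> \sum_s luce a s = 1.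
Proof.
elim: n a => [|n IHn] a a0.
  rewrite (eq_bigr (fun _ => 1)) => [|s _]; last by rewrite /luce big_ord0.
  by rewrite sumr_const card_Sn fact0.
rewrite sum_lift_perm.
under eq_bigr => c _.
  under eq_bigr do rewrite luce_lift.
  rewrite -mulr_sumr IHn ?mulr1; last by move=> j; exact: a0.
  over.
rewrite -mulr_suml divff// gt_eqF// big_ord_recl ltr_pwDl// sumr_ge0// => i _.
exact: ltW.
Qed.

(** Once the top candidate is fixed, the remaining factors form a Luce model on the other candidates
    and sum to 1. *)
Lemma luce_top n (a : 'I_n.+1 -> R) c : (forall j, 0 < a j) ->
  \sum_(s : 'S_n.+1 | s ord0 == c) luce a s = a c / \sum_l a l.
Proof.
move=> a0; rewrite big_mkcond sum_lift_perm (bigD1 c)//= [X in _ + X]big1.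
  rewrite addr0 (eq_bigr (fun s => a c / (\sum_l a l) * luce (a \o lift c) s)).
    by rewrite -mulr_sumr luce_sum ?mulr1// => j; exact: a0.
  by move=> s _; rewrite lift_perm_id eqxx luce_lift.
by move=> d /negPf dc; rewrite big1// => s _; rewrite lift_perm_id dc.
Qed.

End luce.

(** * The pointwise comparison of two utilities *)

Section plurality.
Variables (R : realType) (m : nat) (beta : R).
Hypothesis m2 : (2 <= m)%N.
Hypothesis beta1 : 1 <= beta.
Implicit Types u : utilities R m.

Let beta0 : 0 < beta. Proof. exact: lt_le_trans beta1. Qed.
Let m_gt0 : 0 < m%:R :> R. Proof. by rewrite ltr0n ltnW. Qed.
Let m1_gt0 : 0 < m%:R - 1 :> R. Proof. by rewrite subr_gt0 ltr1n. Qed.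

Let total u := \sum_l expR (beta * tnth u l).

Definition top_prob u c := expR (beta * tnth u c) / total u.

Let total_gt0 u : 0 < total u.
Proof.
have m0 := ltnW m2; rewrite /total (bigD1 (Ordinal m0))//= ltr_pwDl ?expR_gt0//.
by apply: sumr_ge0 => i _; exact: expR_ge0.
Qed.

Lemma plackett_luce_ge0 u s : 0 <= plackett_luce beta u s.
Proof.
by apply: (@luce_ge0 _ _ (fun c => expR (beta * tnth u c))) => j;
  exact: expR_gt0.
Qed.

Lemma plackett_luce_sum u : \sum_s plackett_luce beta u s = 1.
Proof.
by apply: (@luce_sum _ _ (fun c => expR (beta * tnth u c))) => j;
  exact: expR_gt0.
Qed.

Lemma plackett_luce_top u c :
  \sum_(s | ranked_first c s) plackett_luce beta u s = top_prob u c.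
Proof.
rewrite /top_prob /total; clear m_gt0 m1_gt0 total_gt0.
case: m m2 u c => // n _ u c.
rewrite -(@luce_top _ _ (fun c => expR (beta * tnth u c))); last first.
  by move=> j; exact: expR_gt0.
apply: eq_bigl => s; apply/existsP/idP => [[k /andP[/eqP k0 skc]]|sc].
  by rewrite (_ : ord0 = k)//; exact/val_inj.
by exists ord0; rewrite eqxx.
Qed.

Lemma top_prob_ge0 u c : 0 <= top_prob u c.
Proof. by rewrite divr_ge0 ?expR_ge0// ltW. Qed.

Lemma top_prob_le1 u c : top_prob u c <= 1.
Proof.
by rewrite ler_pdivrMr// mul1r /total (bigD1 c)//= lerDl sumr_ge0.
Qed.

Definition plurality_factor : R :=
  Num.min (m%:R * expR beta / (ln (m%:R - 1) + 2))
          (expR beta * (expR beta - 1) / beta).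

Lemma ln_m1_ge0 : 0 <= ln (m%:R - 1) :> R.
Proof. by rewrite ln_ge0// lerBrDr -[1 + 1]/(2%:R) ler_nat. Qed.

Lemma plurality_factor_gt0 : 0 < plurality_factor.
Proof.
have L0 := ln_m1_ge0; rewrite lt_min; apply/andP; split.
  by rewrite divr_gt0 ?mulr_gt0 ?expR_gt0//; lra.
by rewrite divr_gt0 ?mulr_gt0 ?expR_gt0// subr_gt0 expR_gt1.
Qed.

(** With S the common denominator and b = m e^beta / beta, the quantities b (e^(beta u) - 1) / S at
    j and k differ from b p_j and b p_k by the same b / S. Passing from k to j therefore costs
    exactly b (p_k - p_j). *)
Lemma utility_gap u j k : unit_cube u ->
  tnth u k <= plurality_factor * tnth u j +
              m%:R * expR beta / beta * (top_prob u k - top_prob u j).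
Proof.
move=> cu; set x : R := tnth u j; set y : R := tnth u k.
have /andP[x0 x1] := cu j; have /andP[y0 y1] := cu k.
rewrite -/x -/y in x0 x1 y0 y1.
have L0 := ln_m1_ge0; have S0 := total_gt0 u.
set E := expR beta; have E0 : 0 < E := expR_gt0 _.
have ge1 l : 1 <= expR (beta * tnth u l).
  by rewrite -expR0 ler_expR mulr_ge0 ?(ltW beta0)//; case/andP: (cu l).
have leE l : expR (beta * tnth u l) <= E.
  by rewrite ler_expR ler_piMr ?(ltW beta0)//; case/andP: (cu l).
have SE : total u <= m%:R * E.
  rewrite mulr_natl -[in leRHS](card_ord m) -sumr_const; exact: ler_sum.
have Sx : expR (beta * x) + (m%:R - 1) <= total u.
  rewrite /total (bigD1 j)//= lerD2l.
  have -> : m%:R - 1 = \sum_(i < m | i != j) (1 : R).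
    rewrite -[in LHS](card_ord m) -sum1_card natr_sum (bigD1 j)//=.
    by rewrite addrAC subrr add0r.
  exact: ler_sum.
have mS : m%:R <= total u by have := ge1 j; rewrite -/x; lra.
set b := m%:R * E / beta.
have b0 : 0 < b by rewrite divr_gt0// mulr_gt0.
set ex := expR (beta * x); set ey := expR (beta * y).
have ex1 : 1 <= ex := ge1 j.
have ey1 : 1 <= ey := ge1 k.
(* The factor b is chosen so that this is the product of beta y <= e^(beta y) - 1 and S <= m
   e^beta. *)
have yb : y <= b * ((ey - 1) / total u).
  have ey_ge : beta * y <= ey - 1 by rewrite lerBrDl; exact: expR_ge1Dx.
  rewrite (_ : b * _ = (ey - 1) * (m%:R * E) / (beta * total u)); last first.
    by rewrite /b; field; rewrite !gt_eqF.
  rewrite ler_pdivlMr ?mulr_gt0//.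
  rewrite (_ : y * _ = beta * y * total u); last by ring.
  rewrite ler_pM ?(ltW S0)//.
  by rewrite mulr_ge0 ?(ltW beta0).
(* Each entry of the minimum uses its own lower bound on S: the first S >= e^(beta x) + m - 1 with
   [expR_logistic_bound], the second S >= m with the chord bound. *)
have xb : b * ((ex - 1) / total u) <= plurality_factor * x.
  have L2 : 0 < ln (m%:R - 1) + 2 :> R by lra.
  have bx0 : 0 <= beta * x by rewrite mulr_ge0// ltW.
  rewrite /plurality_factor minEle -/E; case: ifP => _.
    rewrite (_ : _ * x = b * (beta * x / (ln (m%:R - 1) + 2))); last first.
      by rewrite /b; field; rewrite !gt_eqF.
    rewrite ler_pM2l// ler_pdivrMr// mulrAC ler_pdivlMr//.
    apply: le_trans (expR_logistic_bound m1_gt0 bx0) _.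
    by rewrite ler_wpM2l.
  rewrite (_ : _ * x = b * ((E - 1) * x / m%:R)); last first.
    by rewrite /b; field; rewrite !gt_eqF.
  have ex_le : ex - 1 <= (E - 1) * x by apply: expR_chord; rewrite x0.
  by rewrite ler_pM2l// ler_pM ?invr_ge0 ?subr_ge0// ?lef_pV2 ?posrE// ltW.
rewrite (_ : top_prob u k - top_prob u j =
   (ey - 1) / total u - (ex - 1) / total u); first by lra.
by rewrite /top_prob -/ex -/ey; field; rewrite gt_eqF.
Qed.

End plurality.

(** * The bound conditional on the utilities *)

Lemma natr_count (R : pzSemiRingType) (T : Type) n (a : pred T) (p : n.-tuple T) :
  (count a p)%:R = \sum_(i < n) (a (tnth p i))%:R :> R.
Proof.
rewrite -sum1_count big_tuple big_mkcond natr_sum.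
by apply: eq_bigr => i _; case: (a _).
Qed.

Section conditional.
Variables (R : realType) (m : nat) (beta : R).
Variable w : forall n : nat, n.-tuple (ranking m) -> 'I_m.
Hypothesis m2 : (2 <= m)%N.
Hypothesis beta1 : 1 <= beta.
Hypothesis w_plurality : plurality_winner w.

(** In the numerator m + 1, the 1 comes from the constant terms of two applications of the
    arithmetic-geometric mean inequality, and m from the second moments of the m first-place
    counts. *)
Definition sampling_error n : R :=
  m%:R * expR beta / beta * (m.+1%:R / Num.sqrt n%:R).

Lemma mean_winner_utility_deterministic n (us : n.-tuple (utilities R m)) :
  mean_winner_utility beta (deterministic_rule R w) us =
  \sum_(p : n.-tuple (ranking m))
    (\prod_(i < n) plackett_luce beta (tnth us i) (tnth p i)) *
    (n%:R^-1 * \sum_(i < n) tnth (tnth us i) (w p)).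
Proof.
apply: eq_bigr => p _; congr (_ * _); rewrite /= (bigD1 (w p))//= eqxx mul1r.
by rewrite [X in _ + X]big1 ?addr0// => c /negPf ->; rewrite mul0r.
Qed.

(** For each profile, [utility_gap] is summed over the voters with j the winner. As the winner
    depends on the profile, the deviations [Y c] of all candidates are controlled together, through
    the sum of their squares. *)
Lemma mean_utility_le n (us : n.-tuple (utilities R m)) k : (0 < n)%N ->
  (forall i, unit_cube (tnth us i)) ->
  n%:R^-1 * \sum_(i < n) tnth (tnth us i) k <=
  plurality_factor m beta * mean_winner_utility beta (deterministic_rule R w) us
  + sampling_error n.
Proof.
move=> n0 cus; set B := plurality_factor m beta.
rewrite mean_winner_utility_deterministic.
pose Q p := \prod_(i < n) plackett_luce beta (tnth us i) (tnth p i).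
pose X c i s : R := (ranked_first c s)%:R - top_prob beta (tnth us i) c.
pose Y c (p : n.-tuple (ranking m)) := \sum_(i < n) X c i (tnth p i).
pose avg c : R := n%:R^-1 * \sum_(i < n) tnth (tnth us i) c.
set r : R := Num.sqrt n%:R; set b := m%:R * expR beta / beta.
have beta0 : 0 < beta by exact: lt_le_trans beta1.
have nR : 0 < n%:R :> R by rewrite ltr0n.
have r0 : 0 < r by rewrite sqrtr_gt0.
have rr : r * r = n%:R by rewrite -expr2 sqr_sqrtr// ltW.
have b0 : 0 < b by rewrite divr_gt0// mulr_gt0 ?expR_gt0// ltr0n ltnW.
have bn0 : 0 < b * n%:R^-1 by exact: divr_gt0.
have Q0 p : 0 <= Q p by apply: prodr_ge0 => i _; exact: plackett_luce_ge0.
have Q1 : \sum_p Q p = 1.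
  apply: (@product_sum1 _ _ _ (fun i s => plackett_luce beta (tnth us i) s)) => i.
  exact: plackett_luce_sum.
have Y2 c : \sum_p Q p * Y c p ^+ 2 <= n%:R.
  apply: (@product_second_moment _ _ _
    (fun i s => plackett_luce beta (tnth us i) s) (X c)).
  - by move=> i s; exact: plackett_luce_ge0.
  - by move=> i; exact: plackett_luce_sum.
  - move=> i; under eq_bigr do rewrite mulrBr.
    rewrite sumrB -mulr_suml plackett_luce_sum mul1r -plackett_luce_top//.
    rewrite [in X in _ - X]big_mkcond/=; apply/eqP; rewrite subr_eq0; apply/eqP.
    by apply: eq_bigr => s _; case: ifP; rewrite ?mulr1 ?mulr0.
  - move=> i s; rewrite /X.
    have p0 := top_prob_ge0 beta m2 (tnth us i) c.
    have p1 := top_prob_le1 beta m2 (tnth us i) c.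
    by rewrite ler_norml; case: ranked_first => /=; lra.
have gap p : avg k <= B * avg (w p) + b * n%:R^-1 * (r + r^-1 * \sum_c Y c p ^+ 2).
  have : avg k <= B * avg (w p) + b * n%:R^-1 *
      \sum_(i < n) (top_prob beta (tnth us i) k - top_prob beta (tnth us i) (w p)).
    rewrite /avg mulrCA -mulrA (mulrCA b) -mulrDr ler_pM2l ?invr_gt0//.
    rewrite !mulr_sumr -big_split /=; apply: ler_sum => i _.
    exact: utility_gap.
  move=> /le_trans; apply; rewrite lerD2l (ler_pM2l bn0).
  have scores : \sum_(i < n) (ranked_first k (tnth p i))%:R <=
                \sum_(i < n) (ranked_first (w p) (tnth p i))%:R :> R.
    by rewrite -!natr_count ler_nat; exact: w_plurality.
  (* This replaces a deviation by its square, so that second moments suffice; r = sqrt n balances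
     the two terms. *)
  have amgm (y : R) : y <= 2^-1 * (r + r^-1 * y ^+ 2).
    rewrite -subr_ge0.
    rewrite (_ : _ - y = 2^-1 * r^-1 * (r - y) ^+ 2); last first.
      by field; rewrite gt_eqF.
    by rewrite mulr_ge0 ?sqr_ge0// mulr_ge0 ?invr_ge0// ltW.
  have sqY c : r^-1 * Y c p ^+ 2 <= r^-1 * \sum_c Y c p ^+ 2.
    rewrite ler_pM2l ?invr_gt0// (bigD1 c)//= lerDl sumr_ge0// => d _.
    exact: sqr_ge0.
  have := amgm (Y (w p) p); have := amgm (- Y k p); rewrite sqrrN.
  have := sqY (w p); have := sqY k.
  have -> : \sum_(i < n) (top_prob beta (tnth us i) k -
      top_prob beta (tnth us i) (w p)) = Y (w p) p - Y k p -
      (\sum_(i < n) (ranked_first (w p) (tnth p i))%:R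
       - \sum_(i < n) (ranked_first k (tnth p i))%:R).
    by rewrite /Y /X !sumrB; ring.
  lra.
change (avg k <= B * (\sum_p Q p * avg (w p)) + sampling_error n).
rewrite -[avg k]mul1r -Q1 mulr_suml.
apply: le_trans (_ : _ <= \sum_p Q p * (B * avg (w p) + b * n%:R^-1 *
  (r + r^-1 * \sum_c Y c p ^+ 2))) _.
  by apply: ler_sum => p _; rewrite ler_wpM2l.
under eq_bigr => p _ do rewrite mulrDr mulrCA [Q p * (b * _ * _)]mulrCA mulrDr.
rewrite big_split /= -mulr_sumr lerD2l -mulr_sumr big_split /= -mulr_suml Q1 mul1r.
under eq_bigr => p _ do rewrite mulrCA mulr_sumr.
rewrite -mulr_sumr exchange_big /= /sampling_error -/b -/r.
have S2 : \sum_c \sum_p Q p * Y c p ^+ 2 <= m%:R * n%:R.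
  rewrite mulr_natl -[in leRHS](card_ord m) -sumr_const.
  by apply: ler_sum => c _; exact: Y2.
apply: le_trans (_ : _ <= b * n%:R^-1 * (r + r^-1 * (m%:R * n%:R))) _.
  by rewrite (ler_pM2l bn0) lerD2l ler_pM2l ?invr_gt0.
rewrite -rr -natr1 le_eqVlt; apply/orP; left; apply/eqP.
by field; rewrite !gt_eqF.
Qed.

End conditional.

(** * Integration against the law of independent draws *)

Lemma integral_full_measure d (T : measurableType d) (R : realType)
    (P : probability T R) (D : set T) (f : T -> \bar R) :
  measurable D -> P D = 1%E -> measurable_fun [set: T] f ->
  (\int[P]_x f x = \int[P]_(x in D) f x)%E.
Proof.
move=> mD PD mf; rewrite [RHS]integral_mkcond.
apply: ae_eq_integral => //.
  apply/(measurable_restrictT _ mD); exact: measurable_funS mf.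
exists (~` D)%classic; split; first exact: measurableC.
  by apply: etrans (probability_setC P mD) _; rewrite PD subee.
by move=> x /= fx Dx; apply: fx => _; rewrite patchE mem_set.
Qed.

Section iid_marginal.
Context d (T : measurableType d) (R : realType).
Variables (P : probability T R) (n : nat).

Lemma measurable_rect (A : set T) : measurable A ->
  measurable [set x : n.-tuple T | forall i, A (tnth x i)].
Proof.
move=> mA; rewrite (_ : mkset _ = (\bigcap_(i in [set: 'I_n])
   ((fun x : n.-tuple T => tnth x i) @^-1` A))%classic); last first.
  by apply/seteqP; split=> x /= Ax i; [move=> _|]; exact: Ax.
apply: fin_bigcap_measurable => [|i _]; first exact: finite_finset.
by rewrite -[(_ @^-1` _)%classic]setTI; exact: measurable_tnth.
Qed.

Lemma iid_law_cube (A : set T) : measurable A -> P A = 1%E ->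
  iid_law P n [set x | forall i, A (tnth x i)] = 1%E.
Proof.
by move=> mA PA; rewrite (iid_law_rect P (fun=> mA)) big1.
Qed.

Lemma iid_law_marginal i (A : set T) : measurable A ->
  iid_law P n ((fun x => tnth x i) @^-1` A)%classic = P A.
Proof.
move=> mA; pose B j := if j == i then A else [set: T].
have mB j : measurable (B j) by rewrite /B; case: ifP.
rewrite (_ : (_ @^-1` _)%classic = [set x | forall j, B j (tnth x j)]).
  rewrite iid_law_rect// (bigD1 i)//= /B eqxx big1 ?mule1// => j /negPf ->.
  exact: probability_setT.
apply/seteqP; split=> x /=; last by move/(_ i); rewrite /B eqxx.
by rewrite /B => Ax j; case: eqP => // ->.
Qed.

Lemma ge0_integral_iid_law i (f : T -> \bar R) :
  measurable_fun [set: T] f -> (forall x, 0 <= f x)%E ->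
  (\int[iid_law P n]_x f (tnth x i) = \int[P]_x f x)%E.
Proof.
move=> mf f0; have mt := @measurable_tnth _ T n i.
rewrite -(@ge0_integral_pushforward _ _ _ _ _ _ mt (iid_law P n) setT f)//.
apply: eq_measure_integral => A mA _; exact: iid_law_marginal.
Qed.

End iid_marginal.

(** * Measurability of the utilities and of the conditional mean *)

Section measurability.
Variables (R : realType) (m : nat).

Lemma measurable_utility c :
  measurable_fun [set: utilities R m] (fun u => tnth u c : R).
Proof. exact: measurable_tnth. Qed.

Lemma measurable_unit_cube : measurable (@unit_cube R m).
Proof.
have -> : @unit_cube R m =
    [set u : utilities R m | forall j, [set x : R | 0 <= x <= 1] (tnth u j)] by [].
apply: measurable_rect.
rewrite (_ : mkset _ = `[0, 1]%classic); first exact: measurable_itv.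
by apply/seteqP; split => x /=; rewrite in_itv.
Qed.

Lemma measurable_plackett_luce beta s :
  measurable_fun [set: utilities R m] (fun u => plackett_luce beta u s).
Proof.
have mexp c : measurable_fun [set: utilities R m]
    (fun u => expR (beta * tnth u c) : R).
  apply: measurableT_comp => //; apply: measurable_funM => //.
  exact: measurable_utility.
apply: measurable_prod => k _.
(* The denominator is positive, so its inverse is [expR (- ln _)]. *)
rewrite [X in measurable_fun _ X](_ : _ = fun u : utilities R m =>
    expR (beta * tnth u (s k)) *
    expR (- ln (\sum_(l < m | (k <= l)%N) expR (beta * tnth u (s l))))).
  apply: measurable_funM; first exact: mexp.
  apply: measurableT_comp => //; apply: measurableT_comp => //.
  apply: measurableT_comp => //.
  under eq_fun do rewrite big_mkcond /=.
  apply: measurable_sum => l; case: (k <= l)%N; first exact: mexp.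
  exact: measurable_cst.
apply/funext => u; rewrite expRN lnK// posrE (bigD1 k)//=.
by rewrite ltr_pwDl ?expR_gt0// sumr_ge0// => l _; exact: expR_ge0.
Qed.

Lemma measurable_mean_winner_utility beta f n :
  measurable_fun [set: n.-tuple (utilities R m)]
    (fun us => mean_winner_utility beta f us).
Proof.
apply: measurable_sum => p; apply: measurable_funM.
  apply: measurable_prod => i _.
  apply: (measurableT_comp (measurable_plackett_luce beta (tnth p i))).
  exact: measurable_tnth.
apply: measurable_sum => c; apply: measurable_funM => //.
apply: measurable_funM => //; apply: measurable_sum => i.
by apply: (measurableT_comp (measurable_utility c)); exact: measurable_tnth.
Qed.

End measurability.

(** * From conditional to expected utilities *)

Section expected_utility.
Variables (R : realType) (m : nat) (beta : R) (V : probability (utilities R m) R).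
Variable w : forall n : nat, n.-tuple (ranking m) -> 'I_m.
Hypothesis V_cube : V (@unit_cube R m) = 1%E.

(** Utilities are nonnegative only almost surely. Integrals are restricted to this set of full
    measure so that the rules for nonnegative integrands apply. *)
Let cube n := [set us : n.-tuple (utilities R m) | forall i, unit_cube (tnth us i)].

Let mcube n : measurable (@cube n).
Proof. apply: measurable_rect; exact: measurable_unit_cube. Qed.

Let law_cube n : iid_law V n (@cube n) = 1%E.
Proof. apply: iid_law_cube => //; exact: measurable_unit_cube. Qed.

Lemma util_unit_cube k :
  util V k = (\int[V]_(u in @unit_cube R m) (tnth u k)%:E)%E.
Proof.
apply: integral_full_measure => //; first exact: measurable_unit_cube.
by apply/measurable_EFinP; exact: measurable_utility.
Qed.

Lemma util_ge0 k : (0 <= util V k)%E.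
Proof.
rewrite util_unit_cube; apply: integral_ge0 => u cu.
by rewrite lee_fin; case/andP: (cu k).
Qed.

Lemma util_le1 k : (util V k <= 1)%E.
Proof.
rewrite util_unit_cube.
have mc := @measurable_unit_cube R m.
apply: (@le_trans _ _ (\int[V]_(u in @unit_cube R m) (cst 1 u))%E).
  apply: ge0_le_integral => //.
  - by move=> u cu; rewrite lee_fin; case/andP: (cu k).
  - apply/measurable_EFinP; apply: measurable_funTS; exact: measurable_utility.
  - by move=> u cu; rewrite lee_fin; case/andP: (cu k).
by rewrite integral_cst// [X in (_ * X)%E]V_cube mul1e.
Qed.

Lemma integral_cube_utility n (i : 'I_n) k :
  (\int[iid_law V n]_(us in @cube n) (tnth (tnth us i) k)%:E = util V k)%E.
Proof.
have mc := @measurable_unit_cube R m.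
(* Extension by zero outside the cube makes the utility nonnegative everywhere, as
   [ge0_integral_iid_law] demands. *)
pose g := (fun u : utilities R m => (tnth u k : R)%:E) \_ (@unit_cube R m).
have mg : measurable_fun setT g.
  apply/(measurable_restrictT _ mc); apply/measurable_EFinP.
  by apply: measurable_funTS; exact: measurable_utility.
have g0 u : (0 <= g u)%E.
  rewrite /g patchE; case: ifPn => //; rewrite inE => cu.
  by rewrite lee_fin; case/andP: (cu k).
rewrite util_unit_cube [RHS]integral_mkcond -(ge0_integral_iid_law V i mg g0).
rewrite [RHS](integral_full_measure (@mcube n) (@law_cube n))//.
  by apply: eq_integral => us; rewrite inE => cus; rewrite /g patchE mem_set.
by apply: (measurableT_comp mg); exact: measurable_tnth.
Qed.

Hypothesis m2 : (2 <= m)%N.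
Hypothesis beta1 : 1 <= beta.
Hypothesis w_plurality : plurality_winner w.

Lemma mean_winner_utility_ge0 f n (us : n.-tuple (utilities R m)) : cube us ->
  0 <= mean_winner_utility beta f us.
Proof.
move=> cus; apply: sumr_ge0 => p _; apply: mulr_ge0.
  by apply: prodr_ge0 => i _; exact: plackett_luce_ge0.
apply: sumr_ge0 => c _; apply: mulr_ge0; first by case: f.
rewrite mulr_ge0// ?invr_ge0//; apply: sumr_ge0 => i _.
by case/andP: (cus i c).
Qed.

Lemma util_rule_cube f n : util_rule beta V f n =
  (\int[iid_law V n]_(us in @cube n) (mean_winner_utility beta f us)%:E)%E.
Proof.
apply: (integral_full_measure (@mcube n) (@law_cube n)).
by apply/measurable_EFinP; exact: measurable_mean_winner_utility.
Qed.

Lemma util_rule_ge0 f n : (0 <= util_rule beta V f n)%E.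
Proof.
rewrite util_rule_cube; apply: integral_ge0 => us cus.
by rewrite lee_fin; exact: mean_winner_utility_ge0.
Qed.

(** This is [mean_utility_le] integrated over the cube: every voter has marginal law [V], so the
    average utility of k integrates to [util V k]. *)
Lemma util_le_util_rule n k : (0 < n)%N ->
  (util V k <= (plurality_factor m beta)%:E *
     util_rule beta V (deterministic_rule R w) n +
   (sampling_error m beta n)%:E)%E.
Proof.
move=> n0; set B := plurality_factor m beta; set e := sampling_error m beta n.
have B0 : 0 < B by exact: plurality_factor_gt0.
have e0 : 0 <= e.
  have beta0 : 0 < beta by exact: lt_le_trans beta1.
  by rewrite mulr_ge0 ?divr_ge0 ?mulr_ge0 ?expR_ge0 ?sqrtr_ge0// ltW.
have mW : measurable_fun (@cube n) (fun us =>
    (mean_winner_utility beta (deterministic_rule R w) us)%:E).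
  apply/measurable_EFinP; apply: measurable_funTS.
  exact: measurable_mean_winner_utility.
have W0 (us : n.-tuple (utilities R m)) : cube us ->
    (0 <= (mean_winner_utility beta (deterministic_rule R w) us)%:E)%E.
  by move=> cus; rewrite lee_fin; exact: mean_winner_utility_ge0.
have mU i : measurable_fun (@cube n) (fun us : n.-tuple (utilities R m) =>
    (tnth (tnth us i) k : R)%:E).
  apply/measurable_EFinP; apply: measurable_funTS.
  by apply: (measurableT_comp (measurable_utility k)); exact: measurable_tnth.
have U0 (i : 'I_n) (us : n.-tuple (utilities R m)) : cube us ->
    (0 <= (tnth (tnth us i) k : R)%:E)%E.
  by move=> cus; rewrite lee_fin; case/andP: (cus i k).
have Ufin : util V k \is a fin_num.
  rewrite ge0_fin_numE ?util_ge0//; apply: le_lt_trans (util_le1 k) _.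
  exact: ltry.
have -> : util V k = (\int[iid_law V n]_(us in @cube n)
    ((n%:R^-1)%:E * \sum_(i < n) (tnth (tnth us i) k : R)%:E))%E.
  rewrite (ge0_integralZl _ (@mcube n))//.
  - rewrite (ge0_integral_sum _ (@mcube n) mU U0).
    under eq_bigr do rewrite integral_cube_utility.
    rewrite -(fineK Ufin) sumEFin -EFinM sumr_const card_ord.
    by rewrite -[fine _ *+ n]mulr_natl mulKf// pnatr_eq0 -lt0n.
  - exact: emeasurable_sum.
  - by move=> us cus; apply: sume_ge0 => i _; exact: U0.
rewrite util_rule_cube -(ge0_integralZl _ (@mcube n) mW W0) ?lee_fin ?(ltW B0)//.
(* The cube has mass 1, so the constant error is its own integral and can join the integrand. *)
have -> : e%:E = (\int[iid_law V n]_(us in @cube n) (cst e%:E us))%E.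
  rewrite (integral_cst _ (@mcube n)) -[LHS]mule1.
  by congr (_ * _)%E; exact/esym/law_cube.
rewrite -(ge0_integralD _ (@mcube n))//; first last.
- by apply: emeasurable_funM => //; exact: measurable_cst.
- by move=> us cus; apply: mule_ge0; [rewrite lee_fin ltW|exact: W0].
apply: (ge0_le_integral _ (@mcube n)).
- move=> us cus; apply: mule_ge0; first by rewrite lee_fin invr_ge0.
  by apply: sume_ge0 => i _; exact: U0.
- apply: emeasurable_funM; first exact: measurable_cst.
  exact: emeasurable_sum.
- apply: emeasurable_funD; last exact: measurable_cst.
  by apply: emeasurable_funM => //; exact: measurable_cst.
- move=> us cus; rewrite sumEFin -!EFinM -EFinD lee_fin.
  exact: mean_utility_le.
Qed.

End expected_utility.

(** * Passage to the limit and the final bound *)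

Lemma limn_esup_le_near (R : realType) (u : nat -> \bar R) (l : \bar R) :
  (\forall n \near \oo, u n <= l)%E -> (limn_esup u <= l)%E.
Proof.
move=> ul; apply: ge_ereal_inf => /=.
(* The upper limit is an infimum of suprema over neighbourhoods of infinity, and the set where u n
   <= l is one of them. *)
exists (ereal_sup (u @` [set n | u n <= l]%E)).
  by exists [set n | u n <= l]%E.
by apply: ge_ereal_sup => _ [n /= unl <-].
Qed.

Lemma sampling_error_near_le (R : realType) m (beta d : R) : 0 < beta -> 0 < d ->
  \forall n \near \oo, sampling_error m beta n <= d.
Proof.
(* For n > 0 the claim amounts to K <= sqrt n. *)
move=> beta0 d0; pose K := m%:R * expR beta / beta * m.+1%:R / d.
have K0 : 0 <= K by rewrite !mulr_ge0 ?expR_ge0 ?invr_ge0// ltW.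
near=> n.
have Kn : K ^+ 2 <= n%:R.
  by near: n; exists (Num.bound (K ^+ 2)) => // n /= Nn;
    rewrite (le_trans (ltW (archi_boundP _))) ?sqr_ge0 ?ler_nat.
(* At n = 0 the convention 0^-1 = 0 makes the error 0. *)
have [->|n0] := eqVneq n 0%N.
  by rewrite /sampling_error sqrtr0 invr0 !mulr0 ltW.
have rn : K <= Num.sqrt n%:R.
  by rewrite -[K]ger0_norm// -sqrtr_sqr ler_wsqrtr.
rewrite /sampling_error mulrA ler_pdivrMr; last first.
  by rewrite sqrtr_gt0 ltr0n lt0n.
by rewrite [leRHS]mulrC -ler_pdivrMr.
Unshelve. all: by end_near. Qed.

Theorem theorem4p2 (R : realType) (m : nat) (beta : R)
    (w : forall n : nat, n.-tuple (ranking m) -> 'I_m) :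
  (2 <= m)%N -> 1 <= beta -> plurality_winner w ->
  (distortion beta (deterministic_rule R w) <=
   (Num.min (m%:R * expR beta / (ln (m%:R - 1) + 2) + 1)
            (expR (2 * beta) / beta))%:E)%E.
Proof.
move=> m2 beta1 w_plurality; set b : R := Num.min _ _.
have beta0 : 0 < beta by exact: lt_le_trans beta1.
have B0 := plurality_factor_gt0 m2 beta1.
(* Strictness comes from the added 1 in the first entry and from e^beta - 1 < e^beta in the second;
   it leaves room for the sampling error. *)
have Bb : plurality_factor m beta < b.
  rewrite /plurality_factor /b lt_min; apply/andP; split.
    by rewrite gt_min ltrDl ltr01.
  rewrite gt_min; apply/orP; right.
  rewrite ltr_pM2r ?invr_gt0// mulrDl mul1r expRD ltr_pM2l ?expR_gt0//.
  by rewrite ltrBlDr ltrDl.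
have b1 : 1 <= b.
  have L0 := ln_m1_ge0 R m2; rewrite le_min; apply/andP; split.
    by rewrite lerDr divr_ge0 ?mulr_ge0 ?expR_ge0//; lra.
  by rewrite ler_pdivlMr// mul1r; have := expR_ge1Dx (2 * beta); lra.
apply: ge_ereal_sup => _ [V /= V_cube <-].
apply: limn_esup_le_near.
have m0 : (0 < m)%N by exact: ltnW.
have U0 : (0 <= max_util V)%E.
  by apply: le_trans (util_ge0 V_cube (Ordinal m0)) _; exact: le_bigmax.
have Ufin : max_util V \is a fin_num.
  rewrite ge0_fin_numE//; apply: (@le_lt_trans _ _ 1%E); last exact: ltry.
  by apply: bigmax_le => [|k _]; [rewrite leNye|exact: util_le1].
move: U0; rewrite le_eqVlt => /orP[/eqP U0|U0].
  (* When all utilities vanish in mean, the ratio is 1 by convention or 0, and 1 <= b covers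
     both. *)
  apply: nearW => n; rewrite /util_ratio -U0 eqxx /=; case: ifP => _.
    by rewrite lee_fin.
  by rewrite mul0e lee_fin (le_trans _ b1).
have [u uE] : exists u, max_util V = u%:E.
  by exists (fine (max_util V)); rewrite fineK.
rewrite uE lte_fin in U0.
(* Since u - d = (B0 / b) u with B0 the plurality factor, an error of at most d turns u <= B0 r +
   error into u <= b r. *)
pose d := (1 - plurality_factor m beta / b) * u.
have b0 : 0 < b by exact: lt_le_trans b1.
have d0 : 0 < d by rewrite mulr_gt0// subr_gt0 ltr_pdivrMr ?mul1r.
near=> n.
have n0 : (0 < n)%N by near: n; exact: nbhs_infty_gt.
have en : sampling_error m beta n <= d by near: n; exact: sampling_error_near_le.
have : (max_util V <= (plurality_factor m beta)%:E *
    util_rule beta V (deterministic_rule R w) n + (sampling_error m beta n)%:E)%E.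
  apply: bigmax_le => [|k _]; first by rewrite leNye.
  exact: util_le_util_rule.
have := util_rule_ge0 beta V_cube (deterministic_rule R w) n.
rewrite /util_ratio uE eqe gt_eqF//=.
(* The value -oo is excluded by nonnegativity, and +oo would make the ratio 0. *)
case: (util_rule _ _ _ _) => [r| |]//=; last first.
  by move=> _ _; rewrite invey mule0 lee_fin ltW.
rewrite -EFinM -EFinD !lee_fin => r0 ur.
have ubr : u <= b * r.
  have : plurality_factor m beta / b * u <= plurality_factor m beta * r.
    by move: ur en; rewrite /d mulrBl mul1r; lra.
  by rewrite -mulrA ler_pM2l// mulrC ler_pdivrMr// [r * b]mulrC.
(* From 0 < u <= b r it follows that r is positive, so the ratio is a genuine real quotient. *)
have rgt0 : 0 < r by rewrite -(pmulr_rgt0 _ b0) (lt_le_trans U0).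
rewrite inver gt_eqF// -EFinM lee_fin ler_pdivrMr//.
Unshelve. all: by end_near. Qed.
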